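(* Let $\Gamma$ be an infinite finitely generated linear group over $\mathbf{C}$ (that is, an infinite finitely generated subgroup of $\mathrm{GL}(m,\mathbf{C})$ for some $m$). Then for any $\delta>0$ there exists an infinite family $\{\Delta_j\}_{j\ge1}$ of normal finite index subgroups of $\Gamma$ such that for all $j$ \[ [\Gamma:\Delta_j] < [\Gamma:\Delta_{j+1}] < [\Gamma:\Delta_j]^{1+\delta}. \] *)

(* Defs.v *)
From HB Require Import structures.
From mathcomp Require Import all_boot all_order all_algebra.
From mathcomp Require Import monoid complex finmap.
From mathcomp Require Import all_classical all_reals all_analysis.

Set Implicit Arguments.
Unset Strict Implicit.
Unset Printing Implicit Defensive.

Import Order.TTheory GRing.Theory Num.Theory.

Local Open Scope classical_set_scope.
Local Open Scope ring_scope.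

(* MathComp's {'GL_n[R]} is only available over a finite ring. *)
Record GL (F : fieldType) (m : nat) : Type := MkGL {
  GLmx :> 'M[F]_m;
  _ : GLmx \in unitmx
}.

Section GLGroup.
Context (F : fieldType) (m : nat).

HB.instance Definition _ := [isSub for @GLmx F m].
HB.instance Definition _ := [Choice of GL F m by <:].

Implicit Types A B C : GL F m.

Lemma GLmx_unit A : GLmx A \in unitmx.
Proof. exact: valP A. Qed.

Lemma GL_mul_unit A B : GLmx A *m GLmx B \in unitmx.
Proof. by rewrite unitmx_mul !GLmx_unit. Qed.

Lemma GL_inv_unit A : invmx (GLmx A) \in unitmx.
Proof. by rewrite unitmx_inv GLmx_unit. Qed.

Definition GL_one : GL F m := MkGL (unitmx1 F m).
Definition GL_mul A B : GL F m := MkGL (GL_mul_unit A B).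
Definition GL_inv A : GL F m := MkGL (GL_inv_unit A).

Lemma GL_mulA : associative GL_mul.
Proof. by move=> A B C; apply: val_inj; rewrite /= mulmxA. Qed.

Lemma GL_mul1 : left_id GL_one GL_mul.
Proof. by move=> A; apply: val_inj; rewrite /= mul1mx. Qed.

Lemma GL_mulr1 : right_id GL_one GL_mul.
Proof. by move=> A; apply: val_inj; rewrite /= mulmx1. Qed.

Lemma GL_mulV : left_inverse GL_one GL_inv GL_mul.
Proof. by move=> A; apply: val_inj; rewrite /= mulVmx ?GLmx_unit. Qed.

Lemma GL_mulrV : right_inverse GL_one GL_inv GL_mul.
Proof. by move=> A; apply: val_inj; rewrite /= mulmxV ?GLmx_unit. Qed.

HB.instance Definition _ := isGroup.Build (GL F m)
  GL_mulA GL_mul1 GL_mulr1 GL_mulV GL_mulrV.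

End GLGroup.

Section Subgroups.
Context (G : groupType).
Implicit Types H K S : set G.

Definition subgroup H : Prop := group_closed [in H].

Definition finitely_generated H : Prop :=
  exists2 S, finite_set S & H = smallest subgroup S.

Definition normal_subgroup K H : Prop :=
  [/\ subgroup K, K `<=` H & forall x g, K x -> H g -> K (x ^ g)%g].

Definition left_cosets H K : set (set G) :=
  [set [set (g * x)%g | x in K] | g in H].

Definition finite_index H K : Prop := finite_set (left_cosets H K).

(* The index [H : K], meaningful only when K has finite index in H;
   fset_set sends infinite sets to the empty finite set. *)
Definition subgroup_index H K : nat := #|` fset_set (left_cosets H K)|.

End Subgroups.

Arguments subgroup {G} H.

(* Main.v *)
From HB Require Import structures.
Require Import Defs.
From mathcomp Require Import all_boot all_order all_algebra all_field.
From mathcomp Require Import complex finmap.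
From mathcomp Require Import all_classical all_reals all_analysis.
From mathcomp Require Import zify ring.

(* Let A = Z[X_1, .., X_n] and f : A -> C be such that the image of f contains
   the entries of Gamma. By specialization of one generator at a
   time there is a morphism phi from A to a finite field k with
   ker f <= ker phi. To an ideal I of A containing ker f corresponds the
   congruence subgroup Gamma(I) of the elements of Gamma that are trivial modulo
   f(I), and the ideals considered are those that are saturated with respect to
   the complement of ker phi. If Gamma(I) is nontrivial, noetherianity gives a
   saturated I' maximal among those contained in I with Gamma(I') <> Gamma(I).
   Let J be the intersection of all the saturated ideals contained in I and
   strictly larger than I'; then Gamma(J) = Gamma(I), so J is itself strictly
   larger than I', and by minimality J / I' is a quotient of A / ker phi, with at
   most #|k| elements. Thus the index of Gamma(I') in Gamma(I) is at most
   C = #|k| ^ (m ^ 2). Iterating gives normal subgroups whose indices in Gamma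
   increase strictly, by a factor at most C at each step; it remains to start
   the sequence where the index is larger than C ^ (1 / delta). *)

Set Implicit Arguments.
Unset Strict Implicit.
Unset Printing Implicit Defensive.

Import Order.TTheory GRing.Theory Num.Theory Pdiv.Idomain.

Local Open Scope classical_set_scope.
Local Open Scope ring_scope.

(** * Noetherian rings *)

Definition is_ideal (A : comNzRingType) (I : set A) : Prop :=
  [/\ I 0, forall x y, I x -> I y -> I (x + y) & forall a x, I x -> I (a * x)].

Definition generated_ideal (A : comNzRingType) (S : set A) : set A :=
  smallest (@is_ideal A) S.

(* Noetherianity as a statement about sequences: it yields ascending chains and
   Hilbert's basis theorem without ever naming the coefficients of a linear
   combination. *)
Definition noetherian (A : comNzRingType) : Prop :=
  forall a : nat -> A, exists N, generated_ideal (a @` `I_N) (a N).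

Section Ideals.
Context (A : comNzRingType).
Implicit Types (I S : set A) (x y : A).

Lemma ideal0 I : is_ideal I -> I 0. Proof. by case. Qed.

Lemma idealD I x y : is_ideal I -> I x -> I y -> I (x + y).
Proof. by case=> _ + _; apply. Qed.

Lemma idealM I a x : is_ideal I -> I x -> I (a * x).
Proof. by case=> _ _; apply. Qed.

Lemma idealN I x : is_ideal I -> I x -> I (- x).
Proof. by move=> idI Ix; rewrite -mulN1r; apply: idealM. Qed.

Lemma idealB I x y : is_ideal I -> I x -> I y -> I (x - y).
Proof. by move=> idI Ix Iy; apply: idealD => //; apply: idealN. Qed.

Lemma generated_ideal_ideal S : is_ideal (generated_ideal S).
Proof.
split=> [I [idI _]|x y Sx Sy I idSI|a x Sx I idSI]; first exact: ideal0.
- have [idI _] := idSI; exact: idealD (Sx _ idSI) (Sy _ idSI).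
- have [idI _] := idSI; exact: idealM (Sx _ idSI).
Qed.

Lemma sub_generated_ideal S : S `<=` generated_ideal S.
Proof. exact: sub_smallest. Qed.

Lemma generated_ideal_min S I : is_ideal I -> S `<=` I -> generated_ideal S `<=` I.
Proof. exact: smallest_sub. Qed.

Lemma generated_idealS S S' :
  S `<=` S' -> generated_ideal S `<=` generated_ideal S'.
Proof.
move=> SS'; apply: generated_ideal_min; first exact: generated_ideal_ideal.
by apply: subset_trans SS' _; exact: sub_generated_ideal.
Qed.

(** The ideals generated by the initial segments have an ideal as increasing union; its finitely
    many generators already lie in one stage. *)
Lemma fg_ideals_noetherian :
  (forall I, is_ideal I ->
    exists2 s : seq A, [set` s] `<=` I & I `<=` generated_ideal [set` s]) ->
  noetherian A.
Proof.
move=> fgA a; pose I x := exists k, generated_ideal (a @` `I_k) x.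
have gen_mono k l : (k <= l)%N ->
    generated_ideal (a @` `I_k) `<=` generated_ideal (a @` `I_l).
  move=> kl; apply: generated_idealS; apply: image_subset => i /= ik.
  exact: leq_trans kl.
have idI : is_ideal I.
  split=> [|x y [k xk] [l yl]|b x [k xk]].
  - by exists 0; exact: ideal0 (generated_ideal_ideal _).
  - exists (maxn k l); apply: (idealD (generated_ideal_ideal _)).
      exact: gen_mono (leq_maxl _ _) _ xk.
    exact: gen_mono (leq_maxr _ _) _ yl.
  - by exists k; exact: idealM (generated_ideal_ideal _) xk.
have [s sI Is] := fgA I idI.
have [N sN] : exists N, [set` s] `<=` generated_ideal (a @` `I_N).
  elim: s sI {Is} => [|x s IHs] sI; first by exists 0 => y.
  have [y sy|N sN] := IHs; first by apply: sI; rewrite /= inE (sy : y \in s) orbT.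
  have [k xk] : I x by apply: sI; rewrite /= mem_head.
  exists (maxn N k) => y /=; rewrite inE => /predU1P[->|/sN yN].
    exact: gen_mono (leq_maxr _ _) _ xk.
  exact: gen_mono (leq_maxl _ _) _ yN.
exists N; apply: (generated_ideal_min (generated_ideal_ideal _) sN).
by apply: Is; exists N.+1; apply: sub_generated_ideal; exists N => /=.
Qed.

(** Otherwise choice yields a strictly increasing sequence in [F], and the elements gained at each
    step contradict the condition on sequences. *)
Lemma noetherian_maximal (F : set (set A)) :
    noetherian A -> (forall I, F I -> is_ideal I) -> F !=set0 ->
  exists2 I, F I & forall I', F I' -> I `<=` I' -> I' `<=` I.
Proof.
move=> noethA idF [I0 FI0]; apply: contrapT => noMax.
have /choice[nxt nxtP] (I : {I | F I}) : exists p : {I | F I} * A,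
    [/\ sval I `<=` sval p.1, sval p.1 p.2 & ~ sval I p.2].
  apply: contrapT => noNext; apply: noMax; exists (sval I); first exact: svalP.
  move=> I' FI' II' x I'x; apply: contrapT => nIx; apply: noNext.
  by exists (exist _ I' FI', x).
pose c k := iter k (fun J => (nxt J).1) (exist _ I0 FI0).
have c_mono k l : (k <= l)%N -> sval (c k) `<=` sval (c l).
  move=> /subnK <-; elim: (l - k)%N => //= d IHd; apply: (subset_trans IHd).
  by case: (nxtP (c (d + k)%N)).
have [N aN] := noethA (fun k => (nxt (c k)).2).
case: (nxtP (c N)) => _ _; apply; apply: generated_ideal_min aN.
  by apply: idF; exact: svalP.
by move=> _ [k kN <-]; apply: (c_mono k.+1) => //; case: (nxtP (c k)).
Qed.

End Ideals.

Lemma noetherian_int : noetherian int.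
Proof.
apply: fg_ideals_noetherian => I idI.
have [[x Ix x0]|I0] := pselect (exists2 x, I x & x != 0); last first.
  exists [::] => // x Ix; have [->|x0] := eqVneq x 0.
    exact: ideal0 (generated_ideal_ideal _).
  by case: I0; exists x.
have exP : exists n, `[< exists2 x, I x & x != 0 /\ `|x|%N = n >].
  by exists `|x|%N; apply/asboolP; exists x.
case: (ex_minnP exP) => _ /asboolP[d Id [d0 <-]] dmin.
exists [:: d] => [y|y Iy] /=; first by rewrite inE => /eqP->.
have -> : y = (y %/ d)%Z * d.
  rewrite [LHS](divz_eq y d); suff -> : (y %% d)%Z = 0 by rewrite addr0.
  apply: contrapT => /eqP r0; suff : (`|d| <= `|(y %% d)%Z|)%N.
    rewrite leqNgt => /negP[]; rewrite -ltz_nat gez0_abs ?modz_ge0 //.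
    by rewrite abszE ltz_mod.
  apply: dmin; apply/asboolP; exists (y %% d)%Z => //.
  have -> : (y %% d)%Z = y - (y %/ d)%Z * d by rewrite {2}(divz_eq y d) addrAC subrr add0r.
  exact: idealB (idealM _ _ _).
apply: (idealM _ (generated_ideal_ideal _)).
by apply: sub_generated_ideal; rewrite /= mem_head.
Qed.

(** Hilbert's basis theorem: each [f k] has least size in [I] outside the ideal of its predecessors,
    and noetherianity of [A] is applied to the leading coefficients. *)
Lemma noetherian_poly (A : comNzRingType) : noetherian A -> noetherian {poly A}.
Proof.
move=> noethA; apply: fg_ideals_noetherian => I idI; apply: contrapT => nfg.
have nxtE (s : seq {poly A}) : exists p, [set` s] `<=` I ->
    [/\ I p, ~ generated_ideal [set` s] p &
      forall q, I q -> ~ generated_ideal [set` s] q -> (size p <= size q)%N].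
  have [sI|] := pselect ([set` s] `<=` I); last by exists 0.
  have exP : exists n, `[< exists p,
      [/\ I p, ~ generated_ideal [set` s] p & size p = n] >].
    apply: contrapT => nex; apply: nfg; exists s => // p Ip; apply: contrapT => ngp.
    by apply: nex; exists (size p); apply/asboolP; exists p.
  case: (ex_minnP exP) => _ /asboolP[p [Ip np <-]] pmin.
  by exists p => _; split=> // q Iq nq; apply/pmin/asboolP; exists q.
have {nxtE}[nxt nxtP] := choice nxtE.
pose L k := iter k (fun s => rcons s (nxt s)) [::].
pose f k := nxt (L k).
have LE k : [set` L k] = f @` `I_k.
  elim: k => [|k IHk]; first by rewrite [L 0%N]/= II0 image_set0; apply/seteqP; split.
  rewrite IIS image_setU -IHk image_set1; apply/seteqP; split=> p /=.
    by rewrite mem_rcons inE => /predU1P[->|]; [right|left].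
  by rewrite mem_rcons inE => -[->|->]; rewrite ?eqxx ?orbT.
have LI k : [set` L k] `<=` I.
  elim: k => [|k IHk] p //=; rewrite mem_rcons inE => /predU1P[->|/IHk//].
  by case: (nxtP (L k) IHk).
pose G k := generated_ideal (f @` `I_k).
have fP k : [/\ I (f k), ~ G k (f k) &
    forall q, I q -> ~ G k q -> (size (f k) <= size q)%N].
  by rewrite /G -LE; apply: nxtP; apply: LI.
have idG k : is_ideal (G k) by exact: generated_ideal_ideal.
have size_f i j : (i <= j)%N -> (size (f i) <= size (f j))%N.
  move=> ij; case: (fP i) => _ _; apply; first by case: (fP j).
  case: (fP j) => _ nGj _ Gi; apply: nGj; apply: generated_idealS Gi.
  by apply: image_subset => k /= ki; apply: leq_trans ij.
have [N aN] := noethA (fun k => lead_coef (f k)).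
have [IfN nGfN fNmin] := fP N.
have fN0 : (0 < size (f N))%N.
  by rewrite size_poly_gt0; apply: contra_notN nGfN => /eqP ->; exact: ideal0.
(* A shift by a power of ['X] puts the leading coefficients of the earlier [f k] in this ideal of
   top coefficients. The resulting [h] cancels the leading term of [f N]. *)
pose I' := [set c | exists h,
  [/\ G N h, (size h <= size (f N))%N & h`_(size (f N)).-1 = c]].
have [h [Gh sh hc]] : I' (lead_coef (f N)).
  apply: generated_ideal_min aN; last first.
    move=> _ [k kN <-]; exists ('X^(size (f N) - size (f k)) * f k).
    have kN' := size_f _ _ (ltnW kN).
    split.
    - by apply: (idealM _ (idG N)); apply: sub_generated_ideal; exists k.
    - apply: leq_trans (size_polyMleq _ _) _.
      by rewrite size_polyXn addSn /= subnK.
    - have sk : (0 < size (f k))%N.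
        rewrite size_poly_gt0; apply/eqP => fk0; case: (fP k) => _ [].
        by rewrite fk0; exact: ideal0.
      rewrite coefXnM lead_coefE; case: ltnP => [|_]; first by lia.
      by congr (_`__); lia.
  split.
  - by exists 0; rewrite coef0 size_poly0; split=> //; exact: ideal0.
  - move=> _ _ [p [Gp sp <-]] [q [Gq sq <-]]; exists (p + q); rewrite coefD; split=> //.
      exact: idealD (idG N) Gp Gq.
    by rewrite (leq_trans (size_polyD _ _)) // geq_max sp.
  - move=> a _ [p [Gp sp <-]]; exists (a *: p); rewrite coefZ; split=> //.
      by rewrite -mul_polyC; exact: idealM (idG N) Gp.
    by rewrite (leq_trans (size_scale_leq _ _)).
have nG : ~ G N (f N - h).
  by move=> Gfh; apply: nGfN; rewrite -(subrK h (f N)); exact: idealD (idG N) Gfh Gh.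
have : (size (f N) <= size (f N - h)%R)%N.
  apply: fNmin => //; apply: (idealB idI IfN); apply: generated_ideal_min Gh => //.
  by move=> _ [k _ <-]; case: (fP k).
rewrite leqNgt => /negP[]; rewrite -(prednK fN0) ltnS.
apply/leq_sizeP => j; rewrite leq_eqVlt coefB => /predU1P[<-|].
  by rewrite hc subrr.
rewrite prednK // => jN.
by rewrite !nth_default ?subrr // (leq_trans sh).
Qed.

(** * Specializations to finite fields *)

Lemma finField_root (k : finFieldType) (p : {poly k}) : (1 < size p)%N ->
  exists (k' : finFieldType) (i : {rmorphism k -> k'}) (x : k'),
    root (map_poly i p) x.
Proof.
move=> sp; have p0 : p != 0 by rewrite -size_poly_gt0 (ltn_trans _ sp).
have [L [rs prs _]] := FinSplittingFieldFor p0.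
pose k' : finFieldType := FinFieldExtType L.
pose i : {rmorphism k -> L} := in_alg L.
exists k', i.
case: rs prs => [|x rs] prs; last first.
  exists x; rewrite -[root _ _]/(root (map_poly i p) x).
  by rewrite (eqp_root prs) big_cons rootM root_XsubC eqxx.
by move: sp; rewrite -(size_map_poly i) (eqp_size prs) big_nil size_poly1.
Qed.

(* Residual finiteness of [A / ker f], with values in fields. *)
Definition finite_specializations (A : idomainType) (K : fieldType) : Prop :=
  forall (f : {rmorphism A -> K}) (b : A), f b != 0 ->
    exists (k : finFieldType) (phi : {rmorphism A -> k}),
      (forall x, f x = 0 -> phi x = 0) /\ phi b != 0.

(** In characteristic zero [f] is injective, and a prime larger than the absolute value of [b] does
    not divide [b]. *)
Lemma finite_specializations_int (K : numFieldType) : finite_specializations int K.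
Proof.
move=> f b; have fE x : f x = x%:~R by rewrite -[x in LHS]intz rmorph_int.
rewrite fE intr_eq0 => b0; have [p bp p_pr] := prime_above `|b|%N.
exists 'F_p, (intr : {rmorphism int -> 'F_p}); split=> [x|].
  by rewrite fE => /eqP; rewrite intr_eq0 => /eqP ->.
have chp := pchar_Fp p_pr; rewrite [b]intEsign /intr rmorphM rmorph_sign /=.
rewrite mulf_eq0 signr_eq0 /= -(dvdn_pcharf chp); apply/negP => /dvdn_leq.
by rewrite absz_gt0 b0 leqNgt bp => /(_ isT).
Qed.

Section PolySpecialization.
Context (A : idomainType) (K : fieldType) (f : {rmorphism {poly A} -> K}).
Implicit Types p q r : {poly A}.

Definition const_part : A -> K := f \o polyC.
HB.instance Definition _ := GRing.RMorphism.on const_part.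

Lemma rmorph_poly_horner p : f p = (map_poly const_part p).[f 'X].
Proof.
rewrite -[p in LHS]coefK poly_def rmorph_sum /= (@horner_coef_wide _ (size p)) ?size_poly //.
by apply: eq_bigr => i _; rewrite coef_map -mul_polyC rmorphM rmorphXn.
Qed.

Definition drop_lead p := p - (lead_coef p)%:P * 'X^((size p).-1).

Lemma size_drop_lead p : p != 0 -> (size (drop_lead p) < size p)%N.
Proof.
move=> p0; have sp : (0 < size p)%N by rewrite size_poly_gt0.
rewrite -[X in (_ < X)%N](prednK sp) ltnS; apply/leq_sizeP => j.
rewrite /drop_lead coefB coefCM coefXn leq_eqVlt => /predU1P[<-|pj].
  by rewrite eqxx mulr1 subrr.
by rewrite gtn_eqF // mulr0 subr0 nth_default // -(prednK sp).
Qed.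

Lemma map_drop_lead p : const_part (lead_coef p) = 0 ->
  map_poly const_part (drop_lead p) = map_poly const_part p.
Proof. by move=> p0; rewrite rmorphB rmorphM /= map_polyC /= p0 mul0r subr0. Qed.

(** Induction on the size: dropping a leading term killed by [const_part] changes neither [f q] nor
    the image of [q]. *)
Lemma map_poly_eq0_below n :
    (forall q, f q = 0 -> (size q < n)%N -> const_part (lead_coef q) = 0) ->
  forall q, f q = 0 -> (size q < n)%N -> map_poly const_part q = 0.
Proof.
move=> ln q; have [m] := ubnP (size q); elim: m => // m IHm in q *.
rewrite ltnS => qm fq qn; have [->|q0] := eqVneq q 0; first by rewrite rmorph0.
have sq := size_drop_lead q0; have lq := ln q fq qn.
rewrite -(map_drop_lead lq); apply: IHm.
- exact: leq_trans sq qm.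
- by rewrite rmorph_poly_horner map_drop_lead // -rmorph_poly_horner.
- exact: ltn_trans qn.
Qed.

(** Here [p] stands for the minimal polynomial of [f 'X] over the fraction field of the image of
    [A]. *)
Lemma minimal_relation : (exists2 p, f p = 0 & map_poly const_part p != 0) ->
  exists p, [/\ f p = 0, const_part (lead_coef p) != 0 &
    forall q, f q = 0 -> (size q < size p)%N -> map_poly const_part q = 0].
Proof.
move=> [p0 fp0 np0].
have exP : exists n, `[< exists p,
    [/\ f p = 0, const_part (lead_coef p) != 0 & size p = n] >].
  apply: contrapT => nex; move/negP: np0; apply.
  apply/eqP; apply: (@map_poly_eq0_below (size p0).+1) => // q fq _.
  apply: contrapT => /eqP nq; apply: nex; exists (size q); apply/asboolP.
  by exists q.
case: (ex_minnP exP) => _ /asboolP[p [fp lp <-]] pmin.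
exists p; split=> //; apply: map_poly_eq0_below => q fq sq.
apply: contraTeq sq => lq; rewrite -leqNgt.
by apply: pmin; apply/asboolP; exists q.
Qed.

(* The Bezout relation between [b] and an irreducible relation [p], without
   passing to the fraction field. *)
Lemma bezout_const p b : f p = 0 -> const_part (lead_coef p) != 0 ->
    (forall q, f q = 0 -> (size q < size p)%N -> map_poly const_part q = 0) ->
    f b != 0 ->
  exists c h, const_part c != 0 /\ const_part c = f b * f h.
Proof.
move=> fp lp pmin fb.
(* Among the polynomials whose value is a nonzero multiple of [f b] in the image of [f], take [r] of
   least size; it will turn out to be constant. *)
have exP : exists n, `[< exists r h,
    [/\ f r != 0, f r = f b * f h & size r = n] >].
  by exists (size b); apply/asboolP; exists b, 1; rewrite rmorph1 mulr1.
case: (ex_minnP exP) => _ /asboolP[r [h [fr rh <-]]] rmin0.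
have rmin q g : f q != 0 -> f q = f b * f g -> (size r <= size q)%N.
  by move=> fq qg; apply: rmin0; apply/asboolP; exists q, g.
have r0 : r != 0 by apply: contraNneq fr => ->; rewrite rmorph0.
have lr : const_part (lead_coef r) != 0.
  apply/eqP => lr; have := size_drop_lead r0; rewrite ltnNge => /negP[].
  have fd : f (drop_lead r) = f r.
    by rewrite rmorph_poly_horner map_drop_lead // -rmorph_poly_horner.
  by apply: (rmin _ h); rewrite fd.
have fZ a q : f (a *: q) = const_part a * f q by rewrite -mul_polyC rmorphM.
have p0 : p != 0.
  by apply: contraNneq lp => ->; rewrite lead_coef0 rmorph0.
have rp : (size r < size p)%N.
  have := congr1 f (divp_eq r p); rewrite rmorphD rmorphM fp mulr0 add0r fZ => E.
  apply: leq_ltn_trans (_ : (size (r %% p)%R < _)%N); last by rewrite ltn_modp.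
  apply: (rmin _ (lead_coef p ^+ scalp r p *: h)); rewrite -E.
    by rewrite mulf_neq0 // rmorphXn expf_neq0.
  by rewrite fZ rh mulrCA.
have [sr|sr] := leqP (size r) 1.
  by exists r`_0, h; rewrite -rh /const_part /= -size1_polyC.
(* If [r] is not constant, pseudo-division of [p] by [r] leaves a remainder of value zero, by
   minimality of [r], so the quotient has value zero too. Both are shorter than [p], hence have zero
   image, against the surviving leading coefficients of [p] and [r]. *)
have /= E := divp_eq p r; have := congr1 f E.
rewrite fZ fp mulr0 rmorphD rmorphM => /esym fE.
have fm : f (p %% r) = 0.
  apply/eqP; apply: contraT => fm.
  have := ltn_modp p r; rewrite r0 ltnNge => /negP[].
  apply: (rmin _ (- (h * (p %/ r)))) => //.
  by rewrite rmorphN mulrN rmorphM mulrA -rh; apply/eqP; rewrite -addr_eq0 addrC mulrC fE.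
move: fE; rewrite fm addr0 => /eqP; rewrite mulf_eq0 (negPf fr) orbF => /eqP fd.
have := congr1 (map_poly const_part) E.
rewrite rmorphD rmorphM /= (pmin _ fm) ?(pmin _ fd) ?mul0r ?addr0.
- move=> /polyP/(_ (size p).-1)/eqP; rewrite coef_map /= coefZ coef0 rmorphM rmorphXn.
  by rewrite mulf_eq0 (negPf lp) orbF expf_eq0 (negPf lr) andbF.
- by rewrite size_divp //; lia.
- by rewrite (ltn_trans _ rp) // ltn_modp.
Qed.

End PolySpecialization.

(** If [f 'X] is algebraic over the image of [A], then ['X] is sent to a root of the specialized
    minimal relation; if it is transcendental, the image of ['X] only has to avoid the roots of
    [b]. *)
Lemma finite_specializations_poly (A : idomainType) (K : fieldType) :
  finite_specializations A K -> finite_specializations {poly A} K.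
Proof.
move=> fsA f b fb; pose f0 : {rmorphism A -> K} := const_part f.
have map0 (k : fieldType) (phi : {rmorphism A -> k}) q :
    (forall x, f0 x = 0 -> phi x = 0) -> map_poly f0 q = 0 -> map_poly phi q = 0.
  move=> ker q0; apply/polyP => i; rewrite coef_map coef0; apply: ker.
  by rewrite -coef_map q0 coef0.
have [rel|norel] := pselect (exists2 p, f p = 0 & map_poly f0 p != 0).
  have [p [fp lp pmin]] := minimal_relation rel.
  have [r [h [r0 rbh]]] := bezout_const fp lp pmin fb.
  (* A nonzero leading coefficient of [p] ensures the kernel condition; a nonzero Bezout constant
     [r] ensures that [b] survives. *)
  have [|k [phi [ker phi_lr]]] := fsA f0 (lead_coef p * r).
    by rewrite rmorphM mulf_neq0.
  move: phi_lr; rewrite rmorphM mulf_eq0 negb_or => /andP[phil phir].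
  have [|k' [i [rho root_rho]]] := @finField_root k (map_poly phi p).
    rewrite size_map_poly_id0 // ltnNge; apply: contra lp => sp.
    rewrite [p in lead_coef p]size1_polyC // lead_coefC.
    by rewrite -[const_part f _]/(f _) -size1_polyC ?fp.
  pose ev : {rmorphism {poly A} -> k'} := horner_morph (fun x : A => mulrC rho ((i \o phi) x)).
  have evE q : ev q = (map_poly i (map_poly phi q)).[rho].
    by rewrite -map_poly_comp.
  have evC a : ev a%:P = i (phi a) by rewrite evE !map_polyC hornerC.
  (* The pseudo-remainder of [q] by [p] is a relation shorter than [p], so it vanishes over [k]; the
     power of the leading coefficient in front of [q] is invertible there. *)
  have ev_ker q : f q = 0 -> ev q = 0.
    move=> fq; have := congr1 ev (divp_eq q p).
    have := congr1 f (divp_eq q p).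
    rewrite -!mul_polyC rmorphD !rmorphM /= fp fq !mulr0 add0r => /esym fm.
    rewrite rmorphD !rmorphM /=.
    rewrite [ev p]evE (eqP root_rho) mulr0 add0r [ev (q %% p)]evE.
    rewrite (map0 _ phi _ ker (pmin _ fm _)); last first.
      rewrite ltn_modp; apply: contraNneq lp => ->.
      by rewrite lead_coef0 rmorph0.
    rewrite rmorph0 horner0 evC !rmorphXn /= => /eqP.
    by rewrite mulf_eq0 expf_eq0 fmorph_eq0 (negPf phil) andbF => /eqP.
  exists k', ev; split=> //; apply/eqP => evb.
  have : ev (r%:P - b * h) = 0.
    by apply: ev_ker; rewrite rmorphB rmorphM -rbh; exact: subrr.
  rewrite rmorphB rmorphM evb mul0r subr0 evC => /eqP.
  by rewrite fmorph_eq0 (negPf phir).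
have f0b : map_poly f0 b != 0.
  by apply: contraNneq fb => b0; rewrite rmorph_poly_horner b0 horner0.
pose j := (size (map_poly f0 b)).-1.
have [|k [phi [ker phib]]] := fsA f0 b`_j.
  by rewrite -coef_map -lead_coefE lead_coef_eq0.
have phib0 : map_poly phi b != 0.
  by apply: contraNneq phib => b0; rewrite -coef_map b0 coef0.
(* A root [rho] of this polynomial makes the value of [b] at [rho] a unit, even if [b] vanishes on
   all of [k]. *)
have [|k' [i [rho]]] := @finField_root k (map_poly phi b * 'X - 1).
  by rewrite size_polyDl size_mulX // ?size_polyN ?size_poly1 ltnS size_poly_gt0.
pose ev : {rmorphism {poly A} -> k'} := horner_morph (fun x : A => mulrC rho ((i \o phi) x)).
have evE q : ev q = (map_poly i (map_poly phi q)).[rho].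
  by rewrite -map_poly_comp.
rewrite rmorphB rmorphM rmorph1 /= map_polyX rootE !hornerE -evE => rhoP.
exists k', ev; split=> [q fq|].
  rewrite evE (map0 _ phi _ ker) ?rmorph0 ?horner0 //; apply/eqP.
  by apply: contraT => q0; case: norel; exists q.
by apply: contraTneq rhoP => ->; rewrite mul0r sub0r oppr_eq0 oner_eq0.
Qed.

Lemma noetherian_presentation (K : numFieldType) (s : seq K) :
  exists (A : idomainType) (f : {rmorphism A -> K}),
    [/\ noetherian A, finite_specializations A K & {subset s <= range f}].
Proof.
elim: s => [|c s [A [f [noethA fsA sf]]]].
  exists int, (intr : {rmorphism int -> K}).
  by split; [exact: noetherian_int|exact: finite_specializations_int|].
pose ev : {rmorphism {poly A} -> K} := horner_morph (fun x => mulrC c (f x)).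
exists {poly A}, ev; split.
- exact: noetherian_poly.
- exact: finite_specializations_poly.
- move=> x; rewrite inE => /predU1P[->|/sf]; rewrite !inE.
    by exists 'X => //; rewrite [LHS]horner_morphX.
  by move=> [a _ <-]; exists a%:P => //; rewrite [LHS]horner_morphC.
Qed.

(** * Cosets and indices *)

Section Index.
Context (G : groupType).
Implicit Types (H N : set G) (x y g : G).

Lemma subgroupP H :
  subgroup H <-> H 1%g /\ forall x y, H x -> H y -> H (x / y)%g.
Proof.
split=> -[H1 HB]; split.
- by move: H1; rewrite inE.
- by move=> x y Hx Hy; have := HB x y; rewrite !inE; apply.
- by rewrite inE.
- by move=> x y; rewrite !inE; apply: HB.
Qed.

Lemma subgroup1 H : subgroup H -> H 1%g.
Proof. by case/subgroupP. Qed.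

Lemma subgroupV H x : subgroup H -> H x -> H x^-1%g.
Proof. by case/subgroupP=> H1 HB Hx; rewrite -div1g; apply: HB. Qed.

Lemma subgroupM H x y : subgroup H -> H x -> H y -> H (x * y)%g.
Proof.
move=> sH Hx Hy; have [_ HB] := (subgroupP H).1 sH.
by rewrite -[y]invgK; apply: HB => //; apply: subgroupV.
Qed.

Definition left_coset N g : set G := [set (g * x)%g | x in N].

Lemma left_cosetE N g x : left_coset N g x <-> N (g^-1 * x)%g.
Proof.
split=> [[y Ny <-]|Nx]; first by rewrite mulKg.
by exists (g^-1 * x)%g => //; rewrite mulVKg.
Qed.

Lemma left_coset_eq N g h : subgroup N ->
  left_coset N g = left_coset N h <-> N (g^-1 * h)%g.
Proof.
move=> sN; split=> [E|Ngh].
  apply/left_cosetE; rewrite E; apply/left_cosetE.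
  by rewrite mulVg; apply: subgroup1.
apply/seteqP; split=> x /left_cosetE Nx; apply/left_cosetE.
  rewrite -[x](mulVKg g) mulgA; apply: subgroupM => //.
  have -> : (h^-1 * g = (g^-1 * h)^-1)%g by rewrite invgM invgK.
  exact: subgroupV.
by rewrite -[x](mulVKg h) mulgA; apply: subgroupM.
Qed.

Lemma card_fset_set_leq (T U : choiceType) (h : T -> U) (A : set U) (s : seq T) :
    A `<=` h @` [set` s] ->
  finite_set A /\ (#|` fset_set A| <= size s)%N.
Proof.
move=> As; have finA : finite_set A.
  exact: sub_finite_set As (finite_image _ (finite_seq _)).
split=> //; rewrite -(size_map h s); apply: leq_trans (size_undup _).
rewrite -card_fseq; apply/fsubset_leq_card/fsubsetP => y.
rewrite in_fset_set // inE => /As[x /= sx <-].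
by rewrite inE; apply: map_f.
Qed.

(** With a representative [r D] chosen in each coset [D] of [N], the coset of [g] modulo [N'] is
    determined by [D = g N] and the value of [rho] at [(r D)^-1 g]. *)
Lemma subgroup_index_leq (T : finType) (rho : G -> T) H N N' :
    subgroup N -> subgroup N' -> finite_index H N ->
    (forall x y, N x -> N y -> rho x = rho y -> N' (x^-1 * y)%g) ->
  finite_index H N' /\ (subgroup_index H N' <= subgroup_index H N * #|T|)%N.
Proof.
move=> sN sN' finN rhoP; pose r (D : set G) := xget 1%g D.
pose P (D : set G) t g := left_coset N g = D /\ rho ((r D)^-1 * g)%g = t.
pose h (p : set G * T) := left_coset N' (xget 1%g (P p.1 p.2)).
rewrite cardE -(size_allpairs pair); apply: (@card_fset_set_leq _ _ h).
move=> _ [g Hg <-]; exists (left_coset N g, rho ((r (left_coset N g))^-1 * g)%g).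
    apply/allpairsP; eexists (_, _); split; last reflexivity.
      by rewrite /= in_fset_set // inE; exists g.
    by rewrite mem_enum.
  rewrite /h /=; case: xgetP => [g' _ [DE rhoE]|nP]; last by case: (nP g).
  have rg : N ((r (left_coset N g))^-1 * g)%g.
    apply/left_coset_eq => //; rewrite /r; case: xgetP => [x _ /left_cosetE|nx].
      by move=> Ngx; apply/esym/left_coset_eq.
    by case: (nx g); apply/left_cosetE; rewrite mulVg; apply: subgroup1.
  have rg' : N ((r (left_coset N g))^-1 * g')%g.
    by apply/left_coset_eq => //; rewrite DE; apply/left_coset_eq.
  apply/left_coset_eq => //; have := rhoP _ _ rg' rg rhoE.
  by rewrite invgM invgK -mulgA mulVKg.
Qed.

(** The map from cosets of [N'] to cosets of [N] stays onto after the removal of [n N'], with [n] in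
    [N] but not in [N'], since [N'] itself has the same image. *)
Lemma subgroup_index_ltn H N N' : subgroup H -> subgroup N -> subgroup N' ->
    N' `<=` N -> N `<=` H -> N' <> N -> finite_index H N' ->
  (subgroup_index H N < subgroup_index H N')%N.
Proof.
move=> sH sN sN' N'N NH neqN finN'.
have [n Nn nN'] : exists2 n, N n & ~ N' n.
  apply: contrapT => nex; apply: neqN; apply/seteqP; split=> // x Nx.
  by apply: contrapT => nN'x; apply: nex; exists x.
pose h (D : set G) := left_coset N (xget 1%g D).
have hE g : h (left_coset N' g) = left_coset N g.
  apply/esym/left_coset_eq => //; case: xgetP => [x _ /left_cosetE/N'N //|nx].
  by case: (nx g); apply/left_cosetE; rewrite mulVg; apply: subgroup1.
have N'n : left_cosets H N' (left_coset N' n) by exists n => //; apply: NH.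
have /= := @card_fset_set_leq _ _ h (left_cosets H N)
  (fset_set (left_cosets H N') `\ left_coset N' n)%fset.
case.
- move=> _ [g Hg <-]; have [Ng|nNg] := pselect (N g).
    exists (left_coset N' 1%g).
      rewrite /= !inE in_fset_set //; apply/andP; split; last first.
        by rewrite inE; exists 1%g => //; apply: subgroup1.
      by apply/eqP => /left_coset_eq; rewrite invg1 mul1g; apply: contra_not nN'; apply.
    rewrite hE; apply/left_coset_eq => //.
    by rewrite invg1 mul1g.
  exists (left_coset N' g); last exact: hE.
  rewrite /= !inE in_fset_set //; apply/andP; split; last by rewrite inE; exists g.
  apply/eqP => /left_coset_eq => /(_ sN') /N'N Ngn; apply: nNg.
  rewrite -[g]invgK; apply: subgroupV => //.
  by rewrite -[(g^-1)%g](mulgK n); apply: subgroupM => //; apply: subgroupV.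
- move=> _.
  rewrite /subgroup_index (cardfsD1 (left_coset N' n) (fset_set (left_cosets H N'))).
  by rewrite in_fset_set // mem_set.
Qed.

End Index.

(** * Congruence subgroups *)

Section Congruence.
Context (K : fieldType) (m : nat) (A : idomainType) (f : {rmorphism A -> K}).
Context (Gamma : set (GL K m)) (sGamma : subgroup Gamma).

Definition mx_over (I : set A) (B : 'M[K]_m) := forall i j, (f @` I) (B i j).

Hypothesis Gamma_over : forall g, Gamma g -> mx_over setT (GLmx g).

Implicit Types (I : set A) (g h : GL K m).

Lemma mx_overB I B C : is_ideal I -> mx_over I B -> mx_over I C -> mx_over I (B - C).
Proof.
move=> idI IB IC i j; rewrite !mxE.
have [[x Ix <-] [y Iy <-]] := (IB i j, IC i j).
by exists (x - y); [exact: idealB|rewrite rmorphB].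
Qed.

Lemma mx_overM I B C : is_ideal I -> mx_over setT B -> mx_over I C ->
  mx_over I (B *m C) /\ mx_over I (C *m B).
Proof.
move=> idI RB IC.
have sumP (F : 'I_m -> K) : (forall i, (f @` I) (F i)) -> (f @` I) (\sum_i F i).
  move=> FI; apply: (big_ind (f @` I)) => //.
    by exists 0; [exact: ideal0|rewrite rmorph0].
  by move=> _ _ [x Ix <-] [y Iy <-]; exists (x + y); [exact: idealD|rewrite rmorphD].
split=> i j; rewrite !mxE; apply: sumP => l.
  have [[x _ <-] [y Iy <-]] := (RB i l, IC l j).
  by exists (x * y); [exact: idealM|rewrite rmorphM].
have [[x _ <-] [y Iy <-]] := (RB l j, IC i l).
by exists (x * y); [exact: idealM|rewrite mulrC rmorphM].
Qed.

Definition congruence_subgroup I : set (GL K m) :=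
  [set g | Gamma g /\ mx_over I (GLmx g - 1%:M)].

Lemma congruence_subgroup_sub I : congruence_subgroup I `<=` Gamma.
Proof. by move=> g []. Qed.

Lemma congruence_subgroupS I I' : I `<=` I' ->
  congruence_subgroup I `<=` congruence_subgroup I'.
Proof.
move=> II' g [Gg Ig]; split=> // i j; have [a Ia <-] := Ig i j.
by exists a => //; apply: II'.
Qed.

Lemma GLmxM g h : GLmx (g * h)%g = GLmx g *m GLmx h. Proof. by []. Qed.

Lemma GLmxVg g : GLmx g^-1%g *m GLmx g = 1%:M.
Proof. by rewrite -GLmxM mulVg. Qed.

Lemma GLmxgV g : GLmx g *m GLmx g^-1%g = 1%:M.
Proof. by rewrite -GLmxM mulgV. Qed.

Lemma mem_congruence_subgroup I g h : is_ideal I -> Gamma g -> Gamma h ->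
  mx_over I (GLmx h - GLmx g) -> congruence_subgroup I (g^-1 * h)%g.
Proof.
move=> idI Gg Gh Igh; split; first by apply: subgroupM => //; apply: subgroupV.
rewrite GLmxM -(GLmxVg g) -mulmxBr.
by have [] := mx_overM idI (Gamma_over (subgroupV sGamma Gg)) Igh.
Qed.

(** [Gamma_over] also applies to inverses, so [x y^-1 - 1 = (x - y) y^-1] and
    [g^-1 x g - 1 = g^-1 (x - 1) g] have entries in the image of [I]. *)
Lemma congruence_subgroup_normal I : is_ideal I ->
  normal_subgroup (congruence_subgroup I) Gamma.
Proof.
move=> idI; split.
- apply/subgroupP; split=> [|x y [Gx Ix] [Gy Iy]].
    split; first exact: subgroup1.
    move=> i j; rewrite subrr mxE; exists 0; last exact: rmorph0.
    exact: ideal0.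
  split; first by apply: subgroupM => //; apply: subgroupV.
  rewrite GLmxM -(GLmxgV y) -mulmxBl.
  rewrite -[GLmx x](subrK 1%:M) -addrA -[_ - GLmx y]opprB.
  by apply: (mx_overM idI (Gamma_over (subgroupV sGamma Gy)) _).2; apply: mx_overB.
- exact: congruence_subgroup_sub.
- move=> x g [Gx Ix] Gg; split.
    by apply: subgroupM; [|exact: subgroupV|exact: subgroupM].
  have -> : GLmx (x ^ g)%g - 1%:M = GLmx g^-1%g *m ((GLmx x - 1%:M) *m GLmx g).
    by rewrite /conjg !GLmxM mulmxBl mul1mx mulmxBr GLmxVg.
  apply: (mx_overM idI (Gamma_over (subgroupV sGamma Gg)) _).1.
  exact: (mx_overM idI (Gamma_over Gg) Ix).2.
Qed.

Lemma congruence_subgroup_subgroup I : is_ideal I -> subgroup (congruence_subgroup I).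
Proof. by case/congruence_subgroup_normal. Qed.

(** * Saturated ideals and steps of bounded index *)

Context (k : finFieldType) (phi : {rmorphism A -> k}).
Hypothesis ker_phi : forall a, f a = 0 -> phi a = 0.

(* The ideals of A / ker f that are contracted from its localization at ker phi *)
Record saturated_ideal I : Prop := SaturatedIdeal {
  saturated_is_ideal : is_ideal I;
  saturated_ker : forall a, f a = 0 -> I a;
  saturatedP : forall s a, phi s != 0 -> I (s * a) -> I a
}.

Lemma saturated_setT : saturated_ideal setT.
Proof. by split. Qed.

(** Saturation holds because [ker f] is prime and contained in [ker phi]. Its congruence subgroup is
    trivial, so it serves as a first candidate in [congruence_index_step]. *)
Lemma saturated_ker_f : saturated_ideal [set a | f a = 0].
Proof.
split=> //= [|s a phis /eqP]; first split=> /= [|x y|a x]; rewrite ?rmorph0 //.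
- by rewrite rmorphD => -> ->; rewrite addr0.
- by rewrite rmorphM => ->; rewrite mulr0.
- rewrite rmorphM mulf_eq0 => /orP[/eqP/ker_phi s0|/eqP//].
  by rewrite s0 eqxx in phis.
Qed.

(** For an ideal [I], the contraction of its extension to the localization at [ker phi]. *)
Definition saturation I : set A := [set a | exists2 s, phi s != 0 & I (s * a)].

Lemma sub_saturation I : I `<=` saturation I.
Proof. by move=> a Ia; exists 1; rewrite ?rmorph1 ?oner_eq0 // mul1r. Qed.

Lemma saturation_saturated I : is_ideal I -> (forall a, f a = 0 -> I a) ->
  saturated_ideal (saturation I).
Proof.
move=> idI kerI; split=> [|a /kerI/sub_saturation //|].
  split=> [|x y [s phis Isx] [t phit Ity]|a x [s phis Isx]].
  - by apply: sub_saturation; exact: ideal0.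
  - exists (s * t); first by rewrite rmorphM mulf_neq0.
    rewrite mulrDr; apply: idealD => //.
      by rewrite mulrAC mulrC; apply: idealM.
    by rewrite -mulrA; apply: idealM.
  - by exists s => //; rewrite mulrCA; apply: idealM.
move=> s a phis [t phit Itsa]; exists (t * s); first by rewrite rmorphM mulf_neq0.
by rewrite -mulrA.
Qed.

Definition add_principal I y : set A := [set a | exists b, I (a - b * y)].

Lemma add_principal_ideal I y : is_ideal I -> is_ideal (add_principal I y).
Proof.
move=> idI; split=> [|a b [c Ia] [d Ib]|a b [c Ib]].
- by exists 0; rewrite mul0r subr0; apply: ideal0.
- by exists (c + d); rewrite mulrDl opprD addrACA; apply: idealD.
- by exists (a * c); rewrite -mulrA -mulrBr; apply: idealM.
Qed.

Lemma sub_add_principal I y : I `<=` add_principal I y.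
Proof. by move=> a Ia; exists 0; rewrite mul0r subr0. Qed.

Lemma mem_add_principal I y : is_ideal I -> add_principal I y y.
Proof. by move=> idI; exists 1; rewrite mul1r subrr; apply: ideal0. Qed.

(** The inverse of [phi s] has to lie in the image of [phi], which may be smaller than [k]; a power
    of [phi s] does. *)
Lemma inverse_mod_ker s : phi s != 0 -> exists t, phi (1 - t * s) = 0.
Proof.
move=> phis; exists (s ^+ #|k|.-2); rewrite rmorphB rmorph1 rmorphM rmorphXn /=.
have k1 := finNzRing_gt1 k.
apply/eqP; rewrite subr_eq0 eq_sym; apply/eqP/(mulIf phis).
rewrite mul1r -!exprSr -[RHS]expf_card; congr (_ ^+ _).
by case: #|k| k1 => [|[]].
Qed.

Lemma congruence_index_step I : noetherian A -> saturated_ideal I ->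
    ~ (congruence_subgroup I `<=` [set 1%g]) ->
  exists I', [/\ saturated_ideal I', I' `<=` I,
    congruence_subgroup I' <> congruence_subgroup I &
    exists rho : GL K m -> 'M[k]_m, forall g h,
      congruence_subgroup I g -> congruence_subgroup I h -> rho g = rho h ->
      congruence_subgroup I' (g^-1 * h)%g].
Proof.
move=> noethA satI nontriv; have idI := saturated_is_ideal satI.
pose F := [set I' | [/\ saturated_ideal I', I' `<=` I &
  congruence_subgroup I' <> congruence_subgroup I]].
have [] := @noetherian_maximal A F noethA.
- by move=> I' [/saturated_is_ideal].
- exists [set a | f a = 0]; split; first exact: saturated_ker_f.
    exact: saturated_ker.
  move=> E; apply: nontriv; rewrite -E => g [_ g1] /=.
  apply/val_inj/matrixP => i j; have [a /= -> /esym/eqP] := g1 i j.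
  by rewrite !mxE subr_eq0 => /eqP.
move=> I1 [sat1 I1I neq1] max1; exists I1; split=> //.
have id1 := saturated_is_ideal sat1.
pose above I2 := [/\ saturated_ideal I2, I1 `<=` I2, I2 `<=` I & ~ I2 `<=` I1].
(* the least saturated ideal strictly larger than I1 and contained in I *)
pose Is : set A := [set a | forall I2, above I2 -> I2 a].
have satIs : saturated_ideal Is.
  split=> [|a fa I2 [sat2 _ _ _]|s a phis Isa I2 ab2].
  - split=> [I2 [sat2 _ _ _]|x y Isx Isy I2 ab2|a x Isx I2 ab2].
    + exact: ideal0 (saturated_is_ideal sat2).
    + have [sat2 _ _ _] := ab2.
      by apply: (idealD (saturated_is_ideal sat2)); [exact: Isx|exact: Isy].
    + have [sat2 _ _ _] := ab2.
      by apply: (idealM _ (saturated_is_ideal sat2)); exact: Isx.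
  - exact: (saturated_ker sat2).
  - by have [sat2 _ _ _] := ab2; apply: (saturatedP sat2 phis); exact: Isa.
have idIs := saturated_is_ideal satIs.
have I1Is : I1 `<=` Is by move=> a I1a I2 [_ + _ _]; apply.
have aboveI : above I.
  split=> // II1; apply: neq1; apply/seteqP; split; exact: congruence_subgroupS.
have IsI : Is `<=` I by move=> a; apply.
(* By maximality of [I1], every [I2] in [above] has the same congruence subgroup as [I]; since [I2]
   contains [ker f], one lift [a] of an entry serves all of them. *)
have GIs : congruence_subgroup I `<=` congruence_subgroup Is.
  move=> g Ig; have [Gg gI] := Ig; split=> // i j; have [a Ia fa] := gI i j.
  exists a => // I2 ab2; have [sat2 I12 I2I nI21] := ab2.
  have E : congruence_subgroup I2 = congruence_subgroup I.
    apply: contrapT => neq2; apply: nI21; apply: max1 => //.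
  have [_ /(_ i j)[a' I2a' fa']] : congruence_subgroup I2 g by rewrite E.
  rewrite -(subrK a' a); apply: idealD (saturated_is_ideal sat2) _ I2a'.
  by apply: (saturated_ker sat2); rewrite rmorphB fa fa' subrr.
have [y Isy nI1y] : exists2 y, Is y & ~ I1 y.
  apply: contrapT => nex; apply: neq1; apply/seteqP; split.
    exact: congruence_subgroupS.
  apply: subset_trans GIs _; apply: congruence_subgroupS => a Isa.
  by apply: contrapT => nI1a; apply: nex; exists a.
(* The saturation of [I1 + (z)] is itself in [above], so it contains the least such ideal. *)
have gen z : Is z -> ~ I1 z -> Is `<=` saturation (add_principal I1 z).
  move=> Isz nI1z a; apply; split.
  - apply: saturation_saturated; first exact: add_principal_ideal.
    by move=> b /(saturated_ker sat1); exact: sub_add_principal.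
  - by move=> b I1b; apply: sub_saturation; exact: sub_add_principal.
  - move=> b [s phis [c I1b]]; apply: (saturatedP satI phis).
    rewrite -(subrK (c * z) (s * b)); apply: (idealD idI); first exact: I1I.
    by apply: (idealM _ idI); exact: IsI.
  - by move=> /(_ z); apply: contra_not nI1z; apply; apply: sub_saturation; exact: mem_add_principal.
(* As in Nakayama's lemma: otherwise [z] is in the saturation of [I1 + (t z)], so [(s - b t) z] is
   in [I1] with [phi (s - b t) = phi s] nonzero, and [z] is in [I1]. *)
have killIs t z : phi t = 0 -> Is z -> I1 (t * z).
  move=> phit Isz; apply: contrapT => nI1tz.
  have Istz : Is (t * z) by exact: (idealM _ idIs).
  have [s phis [b I1szb]] := gen _ Istz nI1tz z Isz.
  apply: nI1tz; apply: (idealM _ id1).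
  apply: (saturatedP sat1 (s := s - b * t)).
    by rewrite rmorphB rmorphM phit mulr0 subr0.
  by rewrite mulrBl -mulrA.
(* Since [t] inverts [s] modulo [ker phi], which kills [Is / I1], the element [y] generates this
   quotient without denominators. *)
have princ z : Is z -> exists c, I1 (z - c * y).
  move=> Isz; have [s phis [b I1szb]] := gen _ Isy nI1y z Isz.
  have [t phits] := inverse_mod_ker phis; exists (t * b).
  have -> : z - t * b * y = (1 - t * s) * z + t * (s * z - b * y).
    by rewrite mulrBl mul1r mulrBr !mulrA addrA subrK.
  by apply: (idealD id1); [exact: killIs|exact: (idealM _ id1)].
(* The matrix [rho g] holds the coordinates along [y] of the entries of [g - 1] modulo [I1], read in
   [k]. By [killIs], equal coordinates in [k] give equal classes modulo [I1]. *)
have /choice[rho rhoP] (g : GL K m) : exists M : 'M[k]_m,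
    congruence_subgroup I g -> forall i j, exists a c,
      [/\ f a = (GLmx g - 1%:M) i j, I1 (a - c * y) & phi c = M i j].
  have [/GIs[_ Isg]|] := pselect (congruence_subgroup I g); last by exists 0.
  have /choice[c cP] (ij : 'I_m * 'I_m) : exists c, exists2 a,
      f a = (GLmx g - 1%:M) ij.1 ij.2 & I1 (a - c * y).
    by have [a Isa fa] := Isg ij.1 ij.2; have [c I1c] := princ a Isa; exists c, a.
  exists (\matrix_(i, j) phi (c (i, j))) => _ i j.
  by have [a fa I1a] := cP (i, j); exists a, (c (i, j)); split; rewrite // mxE.
exists rho => g h Ig Ih rgh; have [[Gg _] [Gh _]] := (Ig, Ih).
apply: (mem_congruence_subgroup id1 Gg Gh) => i j.
have [a [c [fa I1a phic]]] := rhoP g Ig i j.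
have [b [d [fb I1b phid]]] := rhoP h Ih i j.
exists (b - a); last by rewrite rmorphB fa fb !mxE; ring.
have -> : b - a = (b - d * y) - (a - c * y) + (d - c) * y.
  by ring.
apply: (idealD id1); first exact: (idealB id1).
by apply: killIs => //; rewrite rmorphB phic phid rgh subrr.
Qed.

Lemma congruence_chain : noetherian A -> infinite_set Gamma ->
  exists I : nat -> set A, forall j, let N j := congruence_subgroup (I j) in
    [/\ normal_subgroup (N j) Gamma, finite_index Gamma (N j),
      (subgroup_index Gamma (N j) < subgroup_index Gamma (N j.+1))%N &
      (subgroup_index Gamma (N j.+1) <=
         subgroup_index Gamma (N j) * #|{: 'M[k]_m}|)%N].
Proof.
move=> noethA infGamma.
pose good I := saturated_ideal I /\ finite_index Gamma (congruence_subgroup I).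
have /choice[nxt nxtP] (I : {I | good I}) : exists I' : {I | good I},
    let N := congruence_subgroup (sval I) in
    let N' := congruence_subgroup (sval I') in
    [/\ N' `<=` N, N' <> N &
      (subgroup_index Gamma N' <= subgroup_index Gamma N * #|{: 'M[k]_m}|)%N].
  case: I => I [satI finI] /=; have sI := saturated_is_ideal satI.
  have [|I' [satI' I'I neq [rho rhoP]]] := congruence_index_step noethA satI.
    (* Were the congruence subgroup trivial, representatives of its finitely many cosets would
       exhaust [Gamma]. *)
    move=> triv; apply: infGamma; apply: sub_finite_set (finite_image (xget 1%g) finI).
    move=> g Gg; exists (left_coset (congruence_subgroup I) g); first by exists g.
    case: xgetP => [x _ /left_cosetE/triv /= gx|nx].
      by rewrite -[x](mulVKg g) gx mulg1.
    by case: (nx g); apply/left_cosetE; rewrite mulVg; exact: subgroup1 (congruence_subgroup_subgroup sI).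
  have sI' := saturated_is_ideal satI'.
  have [finI' leI'] := subgroup_index_leq (congruence_subgroup_subgroup sI)
    (congruence_subgroup_subgroup sI') finI rhoP.
  exists (exist _ I' (conj satI' finI')); split=> //=.
  exact: congruence_subgroupS.
(* The chain starts at the unit ideal, whose congruence subgroup is [Gamma]. *)
have goodT : good setT.
  have idT := saturated_is_ideal saturated_setT.
  split; first exact: saturated_setT.
  have GT g : Gamma g -> congruence_subgroup setT g.
    move=> Gg; split=> //; apply: mx_overB => //; first exact: Gamma_over.
    exact: (Gamma_over (subgroup1 sGamma)).
  apply: sub_finite_set (finite_set1 (left_coset (congruence_subgroup setT) 1%g)).
  move=> _ [g Gg <-]; apply/left_coset_eq; first exact: congruence_subgroup_subgroup.
  by rewrite mulg1; apply: GT; exact: subgroupV.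
pose I j := iter j nxt (exist _ setT goodT).
exists (fun j => sval (I j)) => j N.
have [satI finI] : good (sval (I j)) := svalP (I j).
have [satI' finI'] : good (sval (I j.+1)) := svalP (I j.+1).
have [NN neq le] := nxtP (I j); split=> //.
  exact/congruence_subgroup_normal/saturated_is_ideal.
apply: subgroup_index_ltn => //; try exact: congruence_subgroup_sub.
- exact/congruence_subgroup_subgroup/saturated_is_ideal.
- exact/congruence_subgroup_subgroup/saturated_is_ideal.
Qed.

End Congruence.

(** * The ring of entries and the growth of the indices *)

Lemma fg_entries (K : fieldType) (m : nat) (Gamma : set (GL K m)) :
  finitely_generated Gamma ->
  exists s : seq K, forall (A : idomainType) (f : {rmorphism A -> K}),
    {subset s <= range f} -> forall g, Gamma g -> mx_over f setT (GLmx g).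
Proof.
move=> [S finS ->].
have /finite_seqP[gs gsE] := finS.
pose ent (g : GL K m) := [seq GLmx g ij.1 ij.2 | ij : 'I_m * 'I_m].
(* The inverses of the generators are included because the subgroup [H] below constrains both a
   matrix and its inverse. *)
exists (flatten [seq ent g ++ ent g^-1%g | g <- gs]) => A f sf g.
pose H := [set g : GL K m | mx_over f setT (GLmx g) /\ mx_over f setT (GLmx g^-1%g)].
suff : smallest subgroup S `<=` H by move=> SH /SH[].
have idT : is_ideal (setT : set A) by [].
apply: smallest_sub.
  apply/subgroupP; split=> [|x y [Rx Rx'] [Ry Ry']].
    have R1 : mx_over f setT (GLmx (1%g : GL K m)).
      by move=> i j; exists (i == j)%:R; rewrite // rmorph_nat mxE.
    by split=> //; rewrite invg1.
  split; first exact: (mx_overM idT Rx Ry').1.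
  by rewrite invgF; exact: (mx_overM idT Ry Rx').1.
move=> x; rewrite gsE => /= xgs.
have memf c : c \in ent x ++ ent x^-1%g -> c \in range f.
  by move=> cx; apply: sf; apply/flatten_mapP; exists x.
by split=> i j; apply/set_mem/memf; rewrite mem_cat;
  apply/orP; [left|right]; apply/mapP; exists (i, j); rewrite ?mem_enum.
Qed.

Theorem theorem1p2 (R : realType) (m : nat) (Gamma : set (GL R[i] m))
    (Gamma_subgroup : subgroup Gamma)
    (Gamma_fg : finitely_generated Gamma)
    (Gamma_infinite : infinite_set Gamma)
    (delta : R) (delta_gt0 : 0 < delta) :
  exists Delta : nat -> set (GL R[i] m),
    forall j : nat, (1 <= j)%N ->
      [/\ normal_subgroup (Delta j) Gamma,
          finite_index Gamma (Delta j),
          (subgroup_index Gamma (Delta j) < subgroup_index Gamma (Delta j.+1))%N &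
          (subgroup_index Gamma (Delta j.+1))%:R
            < ((subgroup_index Gamma (Delta j))%:R : R) `^ (1 + delta)].
Proof.
have [s sP] := fg_entries Gamma_fg.
have [A [f [noethA fsA sf]]] := noetherian_presentation s.
have [|k [phi [ker_phi _]]] := fsA f 1; first by rewrite rmorph1 oner_eq0.
have [I IP] := congruence_chain Gamma_subgroup (sP _ f sf) ker_phi noethA Gamma_infinite.
set n := fun j => subgroup_index Gamma (congruence_subgroup f Gamma (I j)).
have n_ge j : (j <= n j)%N.
  elim: j => // j IHj; apply: leq_ltn_trans IHj _; by have [] := IP j.
pose C := #|{: 'M[k]_m}|.
(* As the [j]-th index is at least [j], every index [N] from [j0] on exceeds [C^(1/delta)], so that
   [C < N^delta]; the bound [N C] on the next index is then below [N^(1 + delta)]. *)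
pose j0 := (Num.truncn ((C%:R : R) `^ delta^-1)).+1.
exists (fun j => congruence_subgroup f Gamma (I (j0 + j)%N)) => j _.
rewrite addnS; have [normI finI lt le] := IP (j0 + j)%N.
split=> //; set N := n (j0 + j)%N.
have N_gt : (C%:R : R) `^ delta^-1 < N%:R.
  apply: lt_le_trans (_ : j0%:R <= _); first exact: truncnS_gt.
  by rewrite ler_nat (leq_trans (leq_addr j j0)).
have N_gt0 : 0 < (N%:R : R) by exact: le_lt_trans (powR_ge0 _ _) N_gt.
have C_lt : C%:R < (N%:R : R) `^ delta.
  have -> : (C%:R : R) = (C%:R `^ delta^-1) `^ delta.
    by rewrite -powRrM mulVf ?gt_eqF // powRr1.
  by rewrite gt0_ltr_powR // nnegrE ?powR_ge0 // ltW.
apply: le_lt_trans (_ : N%:R * C%:R < _); first by rewrite -natrM ler_nat.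
rewrite powRD; last by rewrite (gt_eqF N_gt0) implybT.
by rewrite powRr1 ?ltW // ltr_pM2l.
Qed.
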